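(* Assume $m\ge m_0$, $\sqrt T/r<|w_3|\le\sqrt T/r_{12}$, and $m\ge r\,r_{12}$. Let $q^*=\mathrm{round}\bigl(\operatorname{Re}(w_2\bar w_3)/|w_3|^2\bigr)$ (nearest integer; half-integer ties resolved by the fixed convention of the author's archived script). If $0\le q^*\le\lfloor x_2/x_3\rfloor$ (that is, the move $V(0,q^*,0)$ is admissible: ''$q^*$ lies in the window'') and $q^*\le x_2/(2x_3)$, then the direct $u_2-q^*u_3$ reduction gives a certified witness $s'$; in the subwindow where the central head reduction uses $g\le r_{12}$ subtractions it yields $$m(s')\le14.1\,\frac{m}{r_{12}};$$ with only the displayed half-window hypothesis $q^*\le x_2/(2x_3)$ (and not $g\le r_{12}$), the same computation gives the weaker constant $28.2$, i.e. $m(s')\le28.2\,m/r_{12}$. The complementary case $q^*>x_2/(2x_3)$, and the exits where $q^*$ falls outside the window, are partial and deferred (nothing is asserted for them).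
   Context: $K$ is a cubic number field of signature $(1,1)$, with real embedding $\sigma_r$ and complex embedding $\sigma_c$; $L\subset\mathcal O_K$ is an order. A state is an ordered triple $s=(u_1,u_2,u_3)$ of elements of $L$ forming a $\mathbb Q$-basis of $K$ with $x_i=\sigma_r(u_i)>0$, sorted so that $x_1\ge x_2\ge x_3>0$. Write $r=x_1/x_3$, $r_{12}=x_1/x_2$. Put $\xi=(x_1,x_2,x_3)$, $\nu=(\sigma_c(u_1),\sigma_c(u_2),\sigma_c(u_3))$, $\bar\zeta=\langle\xi,\nu\rangle/|\xi|^2$ (bilinear dot product; this bar is part of the symbol), $w_i=\sigma_c(u_i)-\bar\zeta x_i$ (deviations), $T=\sum_i|w_i|^2$. With $a_\perp,b_\perp\in\mathbb R^3$ the real and imaginary parts of $(w_1,w_2,w_3)$, the conformal module of the state is $m=m(s)=T/(2|a_\perp\times b_\perp|)$; $m_0\ge1$ is a fixed threshold (states with $m\ge m_0$ form the high phase). For $A,B,g\in\mathbb Z_{\ge0}$ the move $V(A,B,g)$ sends $(u_1,u_2,u_3)$ to $(u_1-g(u_2-Bu_3)-Au_3,\ u_2-Bu_3,\ u_3)$; it is admissible if all new real coordinates are positive. The direct $u_2-q^*u_3$ reduction replaces $u_2$ by $u_2-q^*u_3$ and then reduces the head $u_1$ by subtracting $g$ copies of $u_2-q^*u_3$, with central remainders: with $y=x_2-q^*x_3$, one takes $g=\lfloor(x_1-y/2)/y\rfloor$, so that the new head has real coordinate between $y/2$ and $3y/2$. The resulting triple is $s'$. A witness is an admissible candidate (reached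 by admissible moves from $s$) exhibited with a bound on its module. *)

(* Defs.v *)
From mathcomp Require Import all_boot all_order all_algebra all_field.
From mathcomp Require Import reals complex.

Set Implicit Arguments.
Unset Strict Implicit.
Unset Printing Implicit Defensive.

Import Order.TTheory GRing.Theory Num.Theory.
Import ComplexField.Normc.

Local Open Scope ring_scope.
Local Open Scope complex_scope.

(* [K] is a cubic field whose embeddings are exactly [sr] (real) and [sc],
   [conjc \o sc] (a pair of non-real conjugate ones). *)
Definition cubic_signature11 (R : realType) (K : fieldExtType rat)
    (sr : {rmorphism K -> R}) (sc : {rmorphism K -> R[i]}) : Prop :=
  [/\ \dim {:K} = 3%N,
      exists x, complex.Im (sc x) != 0,
      forall tau : {rmorphism K -> R}, tau =1 sr
    & forall tau : {rmorphism K -> R[i]}, (exists x, complex.Im (tau x) != 0) ->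
        tau =1 sc \/ tau =1 conjc \o sc].

Definition is_order (K : fieldExtType rat) (L : {pred K}) : Prop :=
  [/\ subring_closed L,
      forall x, x \in L -> integralOver (intr : int -> K) x
    & exists e : 3.-tuple K,
        basis_of {:K} e /\ forall x, x \in L <-> inIntSpan e x].

(* A triple (u_1, u_2, u_3) is [s : 3.-tuple K] with u_i = s`_(i-1). *)
Definition is_state (R : realType) (K : fieldExtType rat)
    (sr : {rmorphism K -> R}) (L : {pred K}) (s : 3.-tuple K) : Prop :=
  [/\ {subset s <= L},
      basis_of {:K} s,
      forall i, 0 < sr (tnth s i)
    & sorted (fun u v => sr v <= sr u) s].

(* r = x_1 / x_3 and r_12 = x_1 / x_2 *)
Definition ratio13 (R : realType) (K : fieldExtType rat)
    (sr : {rmorphism K -> R}) (s : 3.-tuple K) : R := sr s`_0 / sr s`_2.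

Definition ratio12 (R : realType) (K : fieldExtType rat)
    (sr : {rmorphism K -> R}) (s : 3.-tuple K) : R := sr s`_0 / sr s`_1.

Definition dot (A : comPzRingType) (n : nat) (u v : 'rV[A]_n) : A :=
  \sum_i u 0 i * v 0 i.

Definition cross (A : comPzRingType) (u v : 'rV[A]_3) : 'rV[A]_3 :=
  \row_i (u 0 (i + 1) * v 0 (i + 2) - u 0 (i + 2) * v 0 (i + 1)).

Definition xi_vec (R : realType) (K : fieldExtType rat)
    (sr : {rmorphism K -> R}) (s : 3.-tuple K) : 'rV[R]_3 :=
  \row_i sr (tnth s i).

Definition nu_vec (R : realType) (K : fieldExtType rat)
    (sc : {rmorphism K -> R[i]}) (s : 3.-tuple K) : 'rV[R[i]]_3 :=
  \row_i sc (tnth s i).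

(* The bilinear (not Hermitian) product; the bar of the traditional symbol
   "zeta-bar" is not a complex conjugation. *)
Definition zeta_bar (R : realType) (K : fieldExtType rat)
    (sr : {rmorphism K -> R}) (sc : {rmorphism K -> R[i]})
    (s : 3.-tuple K) : R[i] :=
  dot (map_mx (real_complex R) (xi_vec sr s)) (nu_vec sc s)
    / (dot (xi_vec sr s) (xi_vec sr s))%:C.

(* [deviation sr sc s s`_(i-1)] is w_i. *)
Definition deviation (R : realType) (K : fieldExtType rat)
    (sr : {rmorphism K -> R}) (sc : {rmorphism K -> R[i]})
    (s : 3.-tuple K) (u : K) : R[i] :=
  sc u - zeta_bar sr sc s * (sr u)%:C.

Definition total_deviation (R : realType) (K : fieldExtType rat)
    (sr : {rmorphism K -> R}) (sc : {rmorphism K -> R[i]})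
    (s : 3.-tuple K) : R :=
  \sum_(u <- s) normc (deviation sr sc s u) ^+ 2.

Definition a_perp (R : realType) (K : fieldExtType rat)
    (sr : {rmorphism K -> R}) (sc : {rmorphism K -> R[i]})
    (s : 3.-tuple K) : 'rV[R]_3 :=
  \row_i complex.Re (deviation sr sc s (tnth s i)).

Definition b_perp (R : realType) (K : fieldExtType rat)
    (sr : {rmorphism K -> R}) (sc : {rmorphism K -> R[i]})
    (s : 3.-tuple K) : 'rV[R]_3 :=
  \row_i complex.Im (deviation sr sc s (tnth s i)).

Definition conformal_module (R : realType) (K : fieldExtType rat)
    (sr : {rmorphism K -> R}) (sc : {rmorphism K -> R[i]})
    (s : 3.-tuple K) : R :=
  let c := cross (a_perp sr sc s) (b_perp sr sc s) in
  total_deviation sr sc s / (2 * Num.sqrt (dot c c)).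

Definition move (K : fieldExtType rat) (A B g : nat) (s : 3.-tuple K) :
    3.-tuple K :=
  [tuple s`_0 - (s`_1 - s`_2 *+ B) *+ g - s`_2 *+ A; s`_1 - s`_2 *+ B; s`_2].

Definition admissible (R : realType) (K : fieldExtType rat)
    (sr : {rmorphism K -> R}) (A B g : nat) (s : 3.-tuple K) : Prop :=
  forall i, 0 < sr (tnth (move A B g s) i).

(* Entries of a Q-basis have pairwise distinct real coordinates, so there is
   a unique sorted rearrangement; [conformal_module] is unaffected by it. *)
Definition sort_triple (R : realType) (K : fieldExtType rat)
    (sr : {rmorphism K -> R}) (s : 3.-tuple K) : 3.-tuple K :=
  [tuple of sort (fun u v => sr v <= sr u) s].

Inductive reachable (R : realType) (K : fieldExtType rat)
    (sr : {rmorphism K -> R}) (s : 3.-tuple K) : 3.-tuple K -> Prop :=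
| reachable_refl : reachable sr s s
| reachable_move (t : 3.-tuple K) (A B g : nat) :
    reachable sr s t -> admissible sr A B g t ->
    reachable sr s (sort_triple sr (move A B g t)).

(* [s'] is a witness for [s], certified by the bound [b] on its module. *)
Definition witness (R : realType) (K : fieldExtType rat)
    (sr : {rmorphism K -> R}) (sc : {rmorphism K -> R[i]}) (L : {pred K})
    (s s' : 3.-tuple K) (b : R) : Prop :=
  [/\ is_state sr L s', reachable sr s s' & conformal_module sr sc s' <= b].

(* Rounding to a nearest integer, with an arbitrary convention for ties. *)
Definition nearest_rounding (R : realType) (rnd : R -> int) : Prop :=
  forall x, `|x - (rnd x)%:~R| <= 1 / 2.

Definition qstar (R : realType) (K : fieldExtType rat)
    (sr : {rmorphism K -> R}) (sc : {rmorphism K -> R[i]}) (rnd : R -> int)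
    (s : 3.-tuple K) : int :=
  let w2 := deviation sr sc s s`_1 in
  let w3 := deviation sr sc s s`_2 in
  rnd (complex.Re (w2 * w3^*) / normc w3 ^+ 2).

Definition head_count (R : realType) (K : fieldExtType rat)
    (sr : {rmorphism K -> R}) (q : int) (s : 3.-tuple K) : int :=
  let y := sr s`_1 - q%:~R * sr s`_2 in
  Num.floor ((sr s`_0 - y / 2) / y).

Definition direct_reduction (R : realType) (K : fieldExtType rat)
    (sr : {rmorphism K -> R}) (q : int) (s : 3.-tuple K) : 3.-tuple K :=
  let v := s`_1 - s`_2 *~ q in
  sort_triple sr [tuple s`_0 - v *~ head_count sr q s; v; s`_2].

(* Main.v *)
Require Import Defs.
From mathcomp Require Import all_boot all_order all_algebra all_field.
From mathcomp Require Import reals complex ring lra.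

Import Order.TTheory GRing.Theory Num.Theory.
Import ComplexField.Normc.

Local Open Scope ring_scope.
Local Open Scope complex_scope.

(** Write w_i for the deviations of s and y for the real coordinate of
    v = u_2 - q u_3.  Since vectors orthogonal to xi have a cross product
    parallel to xi, the module equals T |xi| / (2 |V|), where V is the
    determinant of (xi, Re nu, Im nu).  Moves are unimodular, so V is the same
    for s and s', and only the product T |xi| has to be compared
    ([conformal_moduleE], [covolume_move]).  The module does not depend on the
    order of the entries ([perm_conformal_module]), hence sorting is harmless.

    For |xi|, the half-window gives y >= x_2 / 2 > 0, and the new real
    coordinates (head at most 3 y / 2, then y <= x_2, then x_3 <= x_2) satisfy
    |xi'|^2 <= (9/4 + 1 + 1) x_2^2; thus r_12 |xi'| <= sqrt (17/4) |xi|, which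
    is where the gain 1 / r_12 comes from, and sqrt (17/4) <= 33/16.

    For T, zeta-bar is the least-squares multiplier, so that T(s') is bounded by
    the sum of squares computed with the zeta-bar of s instead
    ([total_deviation_min]); this makes the deviations transform linearly.  The
    deviation w_2 - q w_3 of v splits along and across w_3.  Rounding makes the
    component along w_3 at most |w_3| / 2 <= sqrt T / (2 r_12).  The component
    across is |Im (w_2 conj w_3)| / |w_3|, whose numerator is a coordinate of
    the cross product of a_perp and b_perp and hence at most T / (2 m)
    ([sqr_Im_deviation]); as m >= r r_12 and |w_3| > sqrt T / r, this component
    is also at most sqrt T / (2 r_12).  Therefore
    |w_2 - q w_3|^2 <= T / (2 r_12^2) ([sheared_deviation]), and if g <= k r_12
    then |w_1 - g (w_2 - q w_3)|^2 <= 2 T + k^2 T, so that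
    T(s') <= (2 + k^2 + 1/2 + 1) T.

    Altogether m(s') <= (33/16) (7/2 + k^2) m / r_12
    ([conformal_module_move_le]).  The subwindow is k = 1, with constant below
    9.3; in general y >= x_2 / 2 forces g <= x_1 / y <= 2 r_12, that is k = 2,
    with constant below 15.5. *)

(** * Cross products in three-space *)

Section SpaceVectors.

Set Implicit Arguments.
Unset Strict Implicit.

Lemma big_I3 (V : nmodType) (F : 'I_3 -> V) : \sum_i F i = F 0 + F 1 + F 2.
Proof.
rewrite !big_ord_recl big_ord0 addr0 addrA.
by congr (F _ + F _ + F _); apply/val_inj.
Qed.

Lemma crossE (A : comPzRingType) (u v : 'rV[A]_3) :
  [/\ cross u v 0 0 = u 0 1 * v 0 2 - u 0 2 * v 0 1,
      cross u v 0 1 = u 0 2 * v 0 0 - u 0 0 * v 0 2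
    & cross u v 0 2 = u 0 0 * v 0 1 - u 0 1 * v 0 0].
Proof.
by split; rewrite mxE; congr (u _ _ * v _ _ - u _ _ * v _ _); apply/val_inj.
Qed.

Lemma dot_cross_cross (A : comPzRingType) (u v : 'rV[A]_3) :
  dot (cross u v) (cross u v) = dot u u * dot v v - dot u v ^+ 2.
Proof. by have [e0 e1 e2] := crossE u v; rewrite /dot !big_I3 e0 e1 e2; ring. Qed.

(** By the double cross product formula, x is parallel to u x v as soon as it is
    orthogonal to u and v; this is then the equality case of Cauchy-Schwarz. *)
Lemma sqr_triple_product (A : comPzRingType) (x u v : 'rV[A]_3) :
  dot x u = 0 -> dot x v = 0 ->
  dot x (cross u v) ^+ 2 = dot x x * dot (cross u v) (cross u v).
Proof.
move=> xu xv.
have [e0 e1 e2] := crossE u v.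
have bac_cab i : u 0 i * dot x v - v 0 i * dot x u = 0.
  by rewrite xu xv !mulr0 subrr.
transitivity (dot x x * dot (cross u v) (cross u v)
   - \sum_i (u 0 i * dot x v - v 0 i * dot x u) ^+ 2).
  by rewrite /dot !big_I3 e0 e1 e2; ring.
by rewrite big1 ?subr0 // => i _; rewrite bac_cab expr0n.
Qed.

Lemma sqr_normc (R : rcfType) (z : R[i]) :
  normc z ^+ 2 = complex.Re z ^+ 2 + complex.Im z ^+ 2.
Proof. by case: z => a b /=; rewrite sqr_sqrtr // addr_ge0 // sqr_ge0. Qed.

End SpaceVectors.

(** * Deviations and the conformal module *)

Section Deviations.

Set Implicit Arguments.
Unset Strict Implicit.

Variables (R : realType) (K : fieldExtType rat).
Variables (sr : {rmorphism K -> R}) (sc : {rmorphism K -> R[i]}).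
Implicit Types (s t : 3.-tuple K) (u v : K) (z : R[i]).

(** The deviation with an arbitrary multiplier [z] instead of zeta-bar, needed
    because the deviations of s' are compared with the zeta-bar of s. *)
Definition residual z u : R[i] := sc u - z * (sr u)%:C.

Definition normsq_real s : R := \sum_(u <- s) sr u ^+ 2.

Lemma residualB z u v : residual z (u - v) = residual z u - residual z v.
Proof. by rewrite /residual !raddfB /=; ring. Qed.

Lemma residualMn z u n : residual z (u *+ n) = residual z u *+ n.
Proof. by rewrite /residual !raddfMn /= mulrnBl mulrnAr. Qed.

Lemma dot_xi s : dot (xi_vec sr s) (xi_vec sr s) = normsq_real s.
Proof. by rewrite /normsq_real big_tuple; apply: eq_bigr => i _; rewrite mxE. Qed.

Lemma zeta_barE s :
  zeta_bar sr sc s = (\sum_(u <- s) (sr u)%:C * sc u) / (normsq_real s)%:C.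
Proof.
rewrite /zeta_bar dot_xi big_tuple; congr (_ / _).
by apply: eq_bigr => i _; rewrite !mxE.
Qed.

Lemma deviationE s u : deviation sr sc s u = residual (zeta_bar sr sc s) u.
Proof. by []. Qed.

Lemma perm_deviation s t : perm_eq s t ->
  deviation sr sc s =1 deviation sr sc t.
Proof.
move=> st u; rewrite /deviation !zeta_barE /normsq_real.
by rewrite !(perm_big _ st).
Qed.

(** Lagrange's identity turns the norm of the cross product, whose coordinates
    depend on the order of the triple, into sums over its entries. *)
Lemma perm_conformal_module s t : perm_eq s t ->
  conformal_module sr sc s = conformal_module sr sc t.
Proof.
move=> st; rewrite /conformal_module /total_deviation !dot_cross_cross.
have dotE (f g : R[i] -> R) (w : 3.-tuple K) :
    dot (\row_i f (deviation sr sc w (tnth w i)))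
        (\row_i g (deviation sr sc w (tnth w i))) =
    \sum_(u <- w) f (deviation sr sc w u) * g (deviation sr sc w u).
  by rewrite big_tuple; apply: eq_bigr => i _; rewrite !mxE.
have sumE (f : R[i] -> R) :
    \sum_(u <- s) f (deviation sr sc s u) = \sum_(u <- t) f (deviation sr sc t u).
  by rewrite (perm_big _ st); apply: eq_bigr => u _; rewrite (perm_deviation st).
rewrite !dotE (sumE (fun z => normc z ^+ 2)).
rewrite (sumE (fun z => complex.Re z * complex.Re z)).
rewrite (sumE (fun z => complex.Im z * complex.Im z)).
by rewrite (sumE (fun z => complex.Re z * complex.Im z)).
Qed.

(** The normal equation of the least-squares problem solved by zeta-bar. *)
Lemma sum_deviation s : normsq_real s != 0 ->
  \sum_(u <- s) (sr u)%:C * deviation sr sc s u = 0.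
Proof.
move=> s0; rewrite /deviation.
under eq_bigr => u _ do rewrite mulrBr mulrCA -rmorphM -expr2.
rewrite big_split sumrN -mulr_sumr -rmorph_sum /= zeta_barE -/(normsq_real s).
by rewrite divfK ?subrr // -(rmorph0 (real_complex R)) (inj_eq (@complexI R)).
Qed.

(** Pythagoras: the residuals are the deviations plus a multiple of xi, and
    these two vectors are orthogonal. *)
Lemma total_deviation_min s z : normsq_real s != 0 ->
  total_deviation sr sc s <= \sum_(u <- s) normc (residual z u) ^+ 2.
Proof.
move=> s0; rewrite /total_deviation.
set d := z - zeta_bar sr sc s.
have sq u : normc (residual z u) ^+ 2 = normc (deviation sr sc s u) ^+ 2
   + (normc d ^+ 2 * sr u ^+ 2
   - 2 * complex.Re (d^* * ((sr u)%:C * deviation sr sc s u))).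
  have -> : residual z u = deviation sr sc s u - d * (sr u)%:C.
    by rewrite /residual /deviation /d; ring.
  case: (deviation sr sc s u) d => [a b] [c e]; rewrite !sqr_normc /=; ring.
under [leRHS]eq_bigr => u _ do rewrite sq.
rewrite big_split lerDl /= big_split sumrN -!mulr_sumr -raddf_sum -mulr_sumr.
rewrite sum_deviation // mulr0 /= mulr0 subr0.
by rewrite mulr_ge0 ?sqr_ge0 // sumr_ge0 // => u _; rewrite sqr_ge0.
Qed.

(** The determinant of the rows xi, Re nu, Im nu: up to sign and a constant, the
    covolume of the lattice spanned by the triple. *)
Definition covolume s : R :=
  dot (xi_vec sr s) (cross (\row_i complex.Re (sc (tnth s i)))
                           (\row_i complex.Im (sc (tnth s i)))).

(** a_perp and b_perp differ from Re nu and Im nu by multiples of xi, which does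
    not change the determinant, and are orthogonal to xi, so that the
    determinant is |xi| times the norm of their cross product. *)
Lemma conformal_moduleE s : 0 < normsq_real s ->
  conformal_module sr sc s =
    total_deviation sr sc s * Num.sqrt (normsq_real s) / (2 * `|covolume s|).
Proof.
move=> s0; rewrite /conformal_module.
set c := cross _ _.
have orth : dot (xi_vec sr s) (a_perp sr sc s) = 0 /\
            dot (xi_vec sr s) (b_perp sr sc s) = 0.
  have := sum_deviation (lt0r_neq0 s0); rewrite big_tuple => e.
  split.
    rewrite -[RHS](raddf0 (@complex.Re R)) -e raddf_sum.
    by apply: eq_bigr => i _; rewrite !mxE; case: deviation => a b /=; ring.
  rewrite -[RHS](raddf0 (@complex.Im R)) -e raddf_sum.
  by apply: eq_bigr => i _; rewrite !mxE; case: deviation => a b /=; ring.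
have covE : covolume s = dot (xi_vec sr s) c.
  have [e0 e1 e2] := crossE (a_perp sr sc s) (b_perp sr sc s).
  have := crossE (\row_i complex.Re (sc (tnth s i))) (\row_i complex.Im (sc (tnth s i))).
  case=> f0 f1 f2; rewrite /covolume /dot !big_I3 e0 e1 e2 f0 f1 f2 !mxE.
  rewrite /deviation; case: zeta_bar => a b.
  by do 3![case: (sc _) => ? ?] => /=; ring.
have -> : `|covolume s| = Num.sqrt (normsq_real s) * Num.sqrt (dot c c).
  rewrite -sqrtrM ?(ltW s0) // -sqrtr_sqr covE -dot_xi; congr Num.sqrt.
  by rewrite sqr_triple_product; case: orth.
have sq0 : Num.sqrt (normsq_real s) != 0 by rewrite sqrtr_eq0 -ltNge.
have [->|c0] := eqVneq (Num.sqrt (dot c c)) 0; first by rewrite !(mulr0, invr0).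
by field; rewrite sq0 c0.
Qed.

Lemma covolume_move A B g s : covolume (move A B g s) = covolume s.
Proof.
have := crossE (\row_i complex.Re (sc (tnth s i))) (\row_i complex.Im (sc (tnth s i))).
case=> e0 e1 e2.
have := crossE (\row_i complex.Re (sc (tnth (move A B g s) i)))
               (\row_i complex.Im (sc (tnth (move A B g s) i))).
case=> f0 f1 f2.
rewrite /covolume /dot !big_I3 e0 e1 e2 f0 f1 f2 !mxE.
rewrite !(tnth_nth 0) /= !(raddfB, raddfMn) /=.
ring.
Qed.

End Deviations.

(** * Moves and the direct reduction on states *)

Section States.

Set Implicit Arguments.
Unset Strict Implicit.

Variables (R : realType) (K : fieldExtType rat).
Variables (sr : {rmorphism K -> R}) (sc : {rmorphism K -> R[i]}).
Implicit Types (L : {pred K}) (s t : 3.-tuple K).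

Lemma big_triple (V : nmodType) (F : K -> V) s :
  \sum_(u <- s) F u = F s`_0 + F s`_1 + F s`_2.
Proof. by rewrite big_tuple big_I3 !(tnth_nth 0). Qed.

Lemma state_coords L s : is_state sr L s ->
  [/\ sr s`_1 <= sr s`_0, sr s`_2 <= sr s`_1 & 0 < sr s`_2].
Proof.
case=> _ _ pos; case: s pos => [[|a [|b [|c []]]] //= sz] pos.
by move=> /and3P[ab bc _]; split=> //; have := pos 2; rewrite (tnth_nth 0).
Qed.

(** Moves are unimodular, so the old triple lies in the span of the new one; the
    dimension count then makes the new triple a basis. *)
Lemma is_state_move L A B g s : subring_closed L -> is_state sr L s ->
  admissible sr A B g s -> is_state sr L (sort_triple sr (move A B g s)).
Proof.
move=> Lring [sL sbasis _ _] adm.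
have mem_sorted u : (u \in sort_triple sr (move A B g s)) = (u \in move A B g s).
  by rewrite mem_sort.
have [_ LB _] := Lring.
have L0 : 0 \in L by have [L1 _ _] := Lring; rewrite -(subrr 1) LB.
have LN u : u \in L -> - u \in L by move=> uL; rewrite -sub0r LB.
have LD u v : u \in L -> v \in L -> u + v \in L.
  by move=> uL vL; rewrite -(opprK v) LB ?LN.
have LMn u n : u \in L -> u *+ n \in L.
  by move=> uL; elim: n => [|n IHn]; rewrite ?mulr0n // mulrS LD.
have s_L i : (i < 3)%N -> s`_i \in L.
  by move=> i3; apply/sL/mem_nth; rewrite size_tuple.
split.
- move=> u; rewrite mem_sorted !inE => /or3P[] /eqP->;
    by rewrite ?LB ?LMn ?LB ?LMn ?s_L.
- rewrite (perm_basis (Y := move A B g s)) ?perm_sort //.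
  have dim3 : \dim {:K} = 3 by rewrite (size_basis sbasis).
  rewrite basisEdim size_tuple dim3 leqnn andbT.
  have /andP[/eqP <- _] := sbasis; apply/span_subvP => u.
  set M := <<_>>%VS.
  have v3 : s`_2 \in M by apply: memv_span; rewrite !inE eqxx !orbT.
  have v2' : s`_1 - s`_2 *+ B \in M by apply: memv_span; rewrite !inE eqxx !orbT.
  have v1' : s`_0 - (s`_1 - s`_2 *+ B) *+ g - s`_2 *+ A \in M.
    by apply: memv_span; rewrite !inE eqxx.
  have v2 : s`_1 \in M by rewrite -(subrK (s`_2 *+ B) s`_1) rpredD ?rpredMn.
  have v1 : s`_0 \in M.
    rewrite -(subrK ((s`_1 - s`_2 *+ B) *+ g) s`_0) rpredD ?(rpredMn _ v2') //.
    by rewrite -(subrK (s`_2 *+ A) (_ - _ *+ g)) rpredD ?rpredMn.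
  case/(nthP 0) => i; rewrite size_tuple => i3 <-.
  by case: i i3 => [|[|[|]]].
- move=> i; have := mem_tnth i (sort_triple sr (move A B g s)).
  by rewrite mem_sorted => /tnthP[j ->]; apply: adm.
- by apply: sort_sorted => u v; apply: le_total.
Qed.

Lemma reachable_direct_reduction B g s : head_count sr B%:Z s = g%:Z ->
  admissible sr 0 B g s ->
  direct_reduction sr B%:Z s = sort_triple sr (move 0 B g s) /\
  reachable sr s (direct_reduction sr B%:Z s).
Proof.
move=> hg adm.
have e : direct_reduction sr B%:Z s = sort_triple sr (move 0 B g s).
  rewrite /direct_reduction hg; congr (sort_triple sr _).
  by apply: val_inj; rewrite /= mulr0n subr0 !pmulrn.
by split=> //; rewrite e; apply: reachable_move => //; apply: reachable_refl.
Qed.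

(** The central remainder: flooring with the offset y / 2 leaves a head within
    y / 2 of y. *)
Lemma head_count_bounds (q : int) s :
  let y := sr s`_1 - q%:~R * sr s`_2 in
  let g := head_count sr q s in
  0 < y -> y <= sr s`_0 ->
  [/\ 0 <= g, y / 2 <= sr s`_0 - g%:~R * y & sr s`_0 - g%:~R * y <= 3 / 2 * y].
Proof.
move=> y g y0 yx.
have /andP[lo hi] := floor_itv ((sr s`_0 - y / 2) / y).
rewrite -/(head_count sr q s) -/g in lo hi.
rewrite ler_pdivlMr // in lo; rewrite ltr_pdivrMr // intrD in hi.
split; [|lra|lra].
by rewrite /g /head_count -/y floor_ge0 divr_ge0 //; lra.
Qed.

(** Im (w_2 conj w_3) is, up to sign, the first coordinate of the cross product
    of a_perp and b_perp, whose norm is T / (2 m).  A positive module rules out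
    the degenerate value of a division by zero. *)
Lemma sqr_Im_deviation s : 0 < conformal_module sr sc s ->
  4 * conformal_module sr sc s ^+ 2
    * complex.Im (deviation sr sc s s`_1 * (deviation sr sc s s`_2)^*) ^+ 2
  <= total_deviation sr sc s ^+ 2.
Proof.
rewrite /conformal_module; set c := cross _ _; set T := total_deviation _ _ _.
have cc0 : 0 <= dot c c by apply: sumr_ge0 => i _; rewrite -expr2 sqr_ge0.
have [->|c0 _] := eqVneq (Num.sqrt (dot c c)) 0.
  by rewrite mulr0 invr0 mulr0 ltxx.
rewrite expr_div_n exprMn sqr_sqrtr //.
have cc_neq0 : dot c c != 0 by apply: contraNneq c0 => ->; rewrite sqrtr0.
have -> : 4 * (T ^+ 2 / (2 ^+ 2 * dot c c)) = T ^+ 2 / dot c c by field.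
rewrite mulrAC ler_pdivrMr ?lt_def ?cc_neq0 // ler_wpM2l ?sqr_ge0 //.
have [e0 e1 e2] := crossE (a_perp sr sc s) (b_perp sr sc s).
have -> : complex.Im (deviation sr sc s s`_1 * (deviation sr sc s s`_2)^*) ^+ 2
          = c 0 0 ^+ 2.
  rewrite e0 !mxE !(tnth_nth 0) /=.
  by do 2![case: (deviation _ _ _ _) => ? ?] => /=; ring.
rewrite /dot big_I3 -!expr2.
by have := sqr_ge0 (c 0 1); have := sqr_ge0 (c 0 2); lra.
Qed.

End States.

(** * The estimate *)

Section Estimate.

Set Implicit Arguments.
Unset Strict Implicit.

(** Splitting w_2 - n w_3 along and across w_3: each component has square at most
    T / (4 rho^2), the first by rounding and the bound on w_3, the second by the
    bound on Im (w_2 conj w_3). *)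
Lemma sheared_deviation (R : rcfType) (w2 w3 : R[i]) (n : nat) (rho T : R) :
  0 < normc w3 ->
  `|complex.Re (w2 * w3^*) / normc w3 ^+ 2 - n%:R| <= 1 / 2 ->
  4 * rho ^+ 2 * complex.Im (w2 * w3^*) ^+ 2 <= T * normc w3 ^+ 2 ->
  rho ^+ 2 * normc w3 ^+ 2 <= T ->
  2 * rho ^+ 2 * normc (w2 - w3 *+ n) ^+ 2 <= T.
Proof.
move=> w3_gt0; set N := normc w3 ^+ 2; set X := complex.Re _; set Y := complex.Im _.
have N_gt0 : 0 < N by rewrite exprn_gt0.
move=> /ler_normlP[lo hi] YT NT.
have decomp : normc (w2 - w3 *+ n) ^+ 2 * N = (X - n%:R * N) ^+ 2 + Y ^+ 2.
  have -> : w3 *+ n = w3 * n%:R%:C by rewrite rmorph_nat mulr_natr.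
  rewrite /N /X /Y !sqr_normc.
  by case: (w2) (w3) => [a b] [c d] /=; ring.
have X_small : (X - n%:R * N) ^+ 2 <= N ^+ 2 / 4.
  have -> : X - n%:R * N = (X / N - n%:R) * N by field; rewrite gt_eqF.
  rewrite exprMn mulrC ler_pM2l ?exprn_gt0 //; nra.
rewrite -(ler_pM2r N_gt0) -[leLHS]mulrA decomp.
have NNT : rho ^+ 2 * N * N <= T * N by rewrite ler_pM2r.
have : rho ^+ 2 * (X - n%:R * N) ^+ 2 <= rho ^+ 2 * (N ^+ 2 / 4).
  by rewrite ler_wpM2l ?sqr_ge0.
lra.
Qed.

Lemma sqr_normcB_le (R : rcfType) (z w : R[i]) :
  normc (z - w) ^+ 2 <= 2 * normc z ^+ 2 + 2 * normc w ^+ 2.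
Proof.
rewrite !sqr_normc; case: z w => [a b] [c d] /=.
by have := sqr_ge0 (a + c); have := sqr_ge0 (b + d); lra.
Qed.

Variables (R : realType) (K : fieldExtType rat).
Variables (sr : {rmorphism K -> R}) (sc : {rmorphism K -> R[i]}).

(** The real parameter [k] bounds g / r_12, so that one estimate serves both
    constants.  The covolumes agree, and the two factors are bounded separately:
    T' <= (7/2 + k^2) T, and r_12 |xi'| <= (33/16) |xi|. *)
Lemma conformal_module_move_le (s : 3.-tuple K) (B g : nat) (k : R) :
  let y := sr s`_1 - sr s`_2 *+ B in
  let T := total_deviation sr sc s in
  let r12 := ratio12 sr s in
  0 < sr s`_2 -> sr s`_2 <= sr s`_1 -> sr s`_1 <= sr s`_0 ->
  0 < y ->
  `|sr s`_0 - y *+ g| <= 3 / 2 * y ->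
  g%:R <= k * r12 ->
  normc (deviation sr sc s s`_2) <= Num.sqrt T / r12 ->
  2 * r12 ^+ 2 *
    normc (deviation sr sc s s`_1 - deviation sr sc s s`_2 *+ B) ^+ 2 <= T ->
  conformal_module sr sc (move 0 B g s) <=
    33 / 16 * (7 / 2 + k ^+ 2) * (conformal_module sr sc s / r12).
Proof.
move=> y T r12 x3_gt0 x32 x21 y_gt0 head_le g_le w3_le w2_le.
have x2_gt0 := lt_le_trans x3_gt0 x32.
have x1_gt0 := lt_le_trans x2_gt0 x21.
have r12_ge1 : 1 <= r12 by rewrite ler_pdivlMr // mul1r.
have r12_gt0 : 0 < r12 by lra.
have T_ge0 : 0 <= T by apply: sumr_ge0 => u _; rewrite sqr_ge0.
have ns : normsq_real sr s = sr s`_0 ^+ 2 + sr s`_1 ^+ 2 + sr s`_2 ^+ 2.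
  by rewrite /normsq_real big_triple.
have ns' : normsq_real sr (move 0 B g s)
           = (sr s`_0 - y *+ g) ^+ 2 + y ^+ 2 + sr s`_2 ^+ 2.
  by rewrite /normsq_real big_triple /= mulr0n subr0 !(rmorphB, rmorphMn) /=.
have ns_gt0 : 0 < normsq_real sr s by rewrite ns; nra.
have ns'_gt0 : 0 < normsq_real sr (move 0 B g s).
  by rewrite ns' -addrA ltr_wpDl ?sqr_ge0 // ltr_wpDr ?sqr_ge0 // exprn_gt0.
rewrite !conformal_moduleE // covolume_move -/T.
set T' := total_deviation _ _ (move _ _ _ _).
have T'_le : T' <= (7 / 2 + k ^+ 2) * T.
  have := total_deviation_min sc (zeta_bar sr sc s) (lt0r_neq0 ns'_gt0).
  move/le_trans; apply.
  rewrite big_triple /= mulr0n subr0 !(residualB, residualMn) -!deviationE.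
  move: w3_le w2_le; have : T = _ := big_triple _ s.
  set w1 := deviation _ _ _ _; set w2 := deviation _ _ _ _.
  set w3 := deviation _ _ _ _; set v := w2 - _ => TE w3_le w2_le.
  have w3_sq : r12 ^+ 2 * normc w3 ^+ 2 <= T.
    have nn : 0 <= normc w3 by case: (w3) => a b /=; rewrite sqrtr_ge0.
    rewrite ler_pdivlMr // in w3_le.
    have r12w3_ge0 : 0 <= r12 * normc w3 by rewrite mulr_ge0 // ltW.
    by rewrite -(sqr_sqrtr T_ge0) -exprMn ler_sqr ?nnegrE ?sqrtr_ge0 // mulrC.
  have r2_ge1 : 1 <= r12 ^+ 2 by rewrite exprn_ege1.
  have w3_T : normc w3 ^+ 2 <= T.
    by apply: le_trans w3_sq; rewrite ler_peMl ?sqr_ge0.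
  have v_T : 2 * normc v ^+ 2 <= T.
    apply: le_trans w2_le; rewrite -mulrA ler_pM2l ?ltr0n //.
    by rewrite ler_peMl ?sqr_ge0.
  have gv_T : 2 * normc (v *+ g) ^+ 2 <= k ^+ 2 * T.
    have -> : normc (v *+ g) = g%:R * normc v.
      by rewrite (normcMn (v : Rcomplex R)) mulr_natl.
    have g_sq : g%:R ^+ 2 <= k ^+ 2 * r12 ^+ 2.
      rewrite -exprMn ler_sqr ?nnegrE //.
      by apply: le_trans g_le; rewrite ler0n.
    rewrite exprMn mulrCA.
    apply: le_trans (_ : k ^+ 2 * (r12 ^+ 2 * (2 * normc v ^+ 2)) <= _).
      by rewrite [leRHS]mulrA ler_wpM2r // mulr_ge0 ?sqr_ge0.
    by rewrite ler_wpM2l ?sqr_ge0 // mulrCA mulrA.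
  have w1_T : normc w1 ^+ 2 <= T.
    by rewrite TE -addrA lerDl addr_ge0 ?sqr_ge0.
  have := sqr_normcB_le w1 (v *+ g).
  lra.
have ns'_le : Num.sqrt (normsq_real sr (move 0 B g s)) * r12 <=
              33 / 16 * Num.sqrt (normsq_real sr s).
  have r12_sq : r12 = Num.sqrt (r12 ^+ 2) by rewrite sqrtr_sqr ger0_norm ?ltW.
  have c_sq : 33 / 16 = Num.sqrt ((33 / 16) ^+ 2) :> R.
    by rewrite sqrtr_sqr ger0_norm //; lra.
  rewrite r12_sq c_sq -!sqrtrM ?sqr_ge0 ?(ltW ns'_gt0) // ler_sqrt; last first.
    by rewrite mulr_ge0 ?sqr_ge0 // ltW.
  (* The head contributes 9/4, the entries y and x_3 at most 1 each. *)
  have x2_bound : normsq_real sr (move 0 B g s) <= 17 / 4 * sr s`_1 ^+ 2.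
    have y_le : y <= sr s`_1 by rewrite gerBl mulrn_wge0 ?ltW.
    have head_sq : (sr s`_0 - y *+ g) ^+ 2 <= (3 / 2 * y) ^+ 2.
      by rewrite -real_normK ?num_real // ler_sqr ?nnegrE //; lra.
    by rewrite ns'; nra.
  apply: le_trans (_ : 17 / 4 * sr s`_0 ^+ 2 <= _); last first.
    by rewrite ns; have := sqr_ge0 (sr s`_0); have := sqr_ge0 (sr s`_1);
       have := sqr_ge0 (sr s`_2); lra.
  have -> : 17 / 4 * sr s`_0 ^+ 2 = 17 / 4 * sr s`_1 ^+ 2 * r12 ^+ 2.
    by rewrite /r12 /ratio12; field; rewrite gt_eqF.
  by rewrite ler_wpM2r ?sqr_ge0.
rewrite -subr_ge0.
set D := 2 * _.
set a := Num.sqrt _ in ns'_le *; set b := Num.sqrt _ in ns'_le *.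
have -> : 33 / 16 * (7 / 2 + k ^+ 2) * (T * b / D / r12) - T' * a / D
    = ((7 / 2 + k ^+ 2) * T * (33 / 16 * b) - T' * (a * r12)) / r12 / D.
  by rewrite !mulrBl; congr (_ - _); first ring; rewrite mulrA mulfK ?gt_eqF.
have T'_ge0 : 0 <= T' by apply: sumr_ge0 => u _; rewrite sqr_ge0.
have D_ge0 : 0 <= D by rewrite mulr_ge0.
have ar12_ge0 : 0 <= a * r12 by rewrite mulr_ge0 ?sqrtr_ge0 // ltW.
apply: divr_ge0 => //; apply: divr_ge0; last exact: ltW.
by rewrite subr_ge0 ler_pM.
Qed.

End Estimate.

Theorem lemma6p2 (R : realType) (K : fieldExtType rat)
    (sr : {rmorphism K -> R}) (sc : {rmorphism K -> R[i]}) (L : {pred K})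
    (rnd : R -> int) (m0 : R) (s : 3.-tuple K) :
  cubic_signature11 sr sc -> is_order L -> nearest_rounding rnd ->
  1 <= m0 -> is_state sr L s ->
  let m := conformal_module sr sc s in
  let T := total_deviation sr sc s in
  let r := ratio13 sr s in
  let r12 := ratio12 sr s in
  let w3 := deviation sr sc s s`_2 in
  let q := qstar sr sc rnd s in
  let s' := direct_reduction sr q s in
  m0 <= m ->
  Num.sqrt T / r < normc w3 <= Num.sqrt T / r12 ->
  r * r12 <= m ->
  0 <= q <= Num.floor (sr s`_1 / sr s`_2) ->
  q%:~R <= sr s`_1 / (2 * sr s`_2) ->
  witness sr sc L s s' (282 / 10 * (m / r12)) /\
  ((head_count sr q s)%:~R <= r12 ->
     witness sr sc L s s' (141 / 10 * (m / r12))).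
Proof.
move=> _ [Lring _ _] rnd_near m0_ge1 state m T r r12 w3 q s' m0_le.
move=> /andP[w3_gt w3_le] rr12_le /andP[q_ge0 _] q_half.
have [x21 x32 x3_gt0] := state_coords state.
have x2_gt0 := lt_le_trans x3_gt0 x32.
have x1_gt0 := lt_le_trans x2_gt0 x21.
have m_gt0 : 0 < m by lra.
have r12_gt0 : 0 < r12 by rewrite divr_gt0.
have r_gt0 : 0 < r by rewrite divr_gt0.
have T_ge0 : 0 <= T by apply: sumr_ge0 => u _; rewrite sqr_ge0.
have w3_gt0 : 0 < normc w3.
  by apply: le_lt_trans w3_gt; rewrite divr_ge0 ?sqrtr_ge0 ?ltW.
have near := rnd_near (complex.Re (deviation sr sc s s`_1 * w3^*) / normc w3 ^+ 2).
rewrite -/(qstar sr sc rnd s) -/q in near.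
rewrite /s'; move: q_ge0 q_half near; case: (q) => [B|//] _ q_half near.
rewrite -pmulrn in q_half near.
have y_half : B%:R * sr s`_2 <= sr s`_1 / 2.
  move: q_half; rewrite ler_pdivlMr ?mulr_gt0 ?ltr0n //; lra.
have [] := @head_count_bounds R K sr B%:Z s.
- by rewrite -pmulrn; lra.
- by rewrite -pmulrn; have := mulr_ge0 (ler0n R B) (ltW x3_gt0); lra.
case hg : (head_count sr B%:Z s) => [g|//] _.
rewrite -!pmulrn => head_lo head_hi.
set y := sr s`_1 - B%:R * sr s`_2 in head_lo head_hi.
have y_gt0 : 0 < y by rewrite /y; lra.
have yE : sr s`_1 - sr s`_2 *+ B = y by rewrite /y mulr_natl.
have adm : admissible sr 0 B g s.
  suff /allP pos : all (fun u => 0 < sr u) (move 0 B g s).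
    by move=> i; apply/pos/mem_tnth.
  rewrite /= mulr0n subr0 !(rmorphB, rmorphMn) /= yE x3_gt0 y_gt0.
  by rewrite -[y *+ g]mulr_natl !andbT; apply: lt_le_trans head_lo; rewrite divr_gt0.
have [reduE reach] := reachable_direct_reduction hg adm.
have state' : is_state sr L (direct_reduction sr B%:Z s).
  by rewrite reduE; apply: is_state_move.
have sheared : 2 * r12 ^+ 2 *
    normc (deviation sr sc s s`_1 - deviation sr sc s s`_2 *+ B) ^+ 2 <= T.
  have r12w3 : r12 ^+ 2 * normc w3 ^+ 2 <= T.
    have r12w3_ge0 : 0 <= r12 * normc w3 by rewrite mulr_ge0 // ltW.
    rewrite -(sqr_sqrtr T_ge0) -exprMn ler_sqr ?nnegrE ?sqrtr_ge0 //.
    by rewrite mulrC -ler_pdivlMr.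
  apply: sheared_deviation => //.
  have rw3 : T <= r ^+ 2 * normc w3 ^+ 2.
    have rw3_ge0 : 0 <= r * normc w3 by rewrite mulr_ge0 // ltW.
    rewrite -(sqr_sqrtr T_ge0) -exprMn ler_sqr ?nnegrE ?sqrtr_ge0 //.
    by rewrite mulrC -ler_pdivrMr // ltW.
  (* The component across w_3: Im^2 <= T^2 / (4 m^2) with m >= r r_12. *)
  have rr12_sq : (r * r12) ^+ 2 <= m ^+ 2.
    by rewrite ler_sqr ?nnegrE // ltW // mulr_gt0.
  have := sqr_Im_deviation m_gt0; rewrite -/m -/T -/w3.
  set Y := complex.Im _ ^+ 2 => ImT.
  have Y_ge0 : 0 <= Y by rewrite sqr_ge0.
  have r2_gt0 : 0 < r ^+ 2 by rewrite exprn_gt0.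
  rewrite -(ler_pM2l r2_gt0).
  apply: le_trans (_ : 4 * (r * r12) ^+ 2 * Y <= _); first by rewrite (exprMn _ r); lra.
  apply: le_trans (_ : 4 * m ^+ 2 * Y <= _).
    by rewrite ler_wpM2r // ler_pM2l ?ltr0n.
  by apply: (le_trans ImT); rewrite expr2 mulrCA ler_wpM2l.
have module_le (k c : R) : g%:R <= k * r12 -> 33 / 16 * (7 / 2 + k ^+ 2) <= c ->
    witness sr sc L s (direct_reduction sr B%:Z s) (c * (m / r12)).
  move=> g_le c_ge; split=> //; rewrite reduE.
  rewrite (@perm_conformal_module _ _ _ _ _ (move 0 B g s)) ?perm_sort //.
  apply: le_trans (_ : _ <= 33 / 16 * (7 / 2 + k ^+ 2) * (m / r12)) _.
    apply: conformal_module_move_le => //; rewrite yE //.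
    by rewrite ger0_norm -[y *+ g]mulr_natl; lra.
  by rewrite ler_wpM2r // divr_ge0 ?ltW.
split=> [|g_le]; last by apply: (module_le 1); [rewrite mul1r|lra].
(* In general g y <= x_1 and x_2 <= 2 y, whence g <= 2 r_12. *)
apply: (module_le 2); last lra.
rewrite /r12 /ratio12 mulrA ler_pdivlMr //.
have : g%:R * sr s`_1 <= g%:R * (2 * y) by rewrite ler_wpM2l ?ler0n //; rewrite /y; lra.
lra.
Qed.
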